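(* Let $A$ and $B$ be monounary algebras. Then $A\times B$ is completely separable if and only if one of the following is true: (1) $A$ and $B$ are completely separable; (2) $A$ is backwards-bounded; (3) $B$ is backwards-bounded.
   Context: $\mathbb{N}$ is the set of non-negative integers. A monounary algebra $(A,f)$ is a (possibly empty) set $A$ with a function $f:A\to A$. A homomorphism $\phi:(A,f_1)\to(B,f_2)$ is a function with $\phi(f_1(a))=f_2(\phi(a))$ for all $a\in A$. The direct product of $(A,f_1)$ and $(B,f_2)$ is $A\times B$ with operation $f(a,b)=(f_1(a),f_2(b))$. $A$ is completely separable if for every $a\in A$ there exist a finite monounary algebra $F$ and a homomorphism $\phi:A\to F$ such that $\phi(a)\notin\phi(A\setminus\{a\})$. For $a\in A$ and $n\in\mathbb{N}$, $f^{-n}(a)=\{b\in A: f^n(b)=a\}$ (with $f^0$ the identity). $(A,f)$ is backwards-bounded if for all $a\in A$ there exists $n\in\mathbb{N}$ such that $f^{-n}(a)=\varnothing$. ''One of the following'' means at least one. *)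

(* Defs.v *)
From mathcomp Require Import all_boot.
From mathcomp Require Import boolp classical_sets.

Set Implicit Arguments.
Unset Strict Implicit.
Unset Printing Implicit Defensive.

Local Open Scope classical_set_scope.

Record monounary := Monounary { carrier :> Type; op : carrier -> carrier }.

Arguments op {m} _.

Definition is_hom (A B : monounary) (phi : A -> B) : Prop :=
  forall a : A, phi (op a) = op (phi a).

Definition prod_alg (A B : monounary) : monounary :=
  @Monounary (A * B)%type (fun p => (op p.1, op p.2)).

Definition completely_separable (A : monounary) : Prop :=
  forall a : A, exists (F : finType) (g : F -> F) (phi : A -> Monounary g),
    is_hom phi /\ ~ (phi @` ([set: A] `\` [set a])) (phi a).

Definition preimage_iter (A : monounary) (n : nat) (a : A) : set A :=
  [set b | iter n op b = a].

Definition backwards_bounded (A : monounary) : Prop :=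
  forall a : A, exists n : nat, preimage_iter n a = set0.

(* Main.v *)
Require Import Defs.
From mathcomp Require Import all_boot.
From mathcomp Require Import boolp classical_sets.

Set Implicit Arguments.
Unset Strict Implicit.
Unset Printing Implicit Defensive.

Local Open Scope classical_set_scope.

(** Everything rests on a criterion that no longer mentions finite algebras
    ([separable_pointP]): a point [a] can be isolated by a homomorphism to a
    finite algebra exactly when the first hitting times of [a] are bounded, that
    is, when some [N] is such that every orbit reaching [a] does so within [N]
    steps.

    If [A] is backwards-bounded, an orbit of the product can hit [(a, b)] only
    at a time at which its first component hits [a], and those times are
    bounded; the criterion then holds at [(a, b)] whatever [B] is. If both
    factors are completely separable, the product of two isolating homomorphisms
    isolates the pair.

    Conversely, suppose that [B] is not backwards-bounded, and let [b] be a point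
    with iterated preimages of every order. An orbit of [A] hitting [a] at time
    [n] can be paired with an orbit of [B] hitting [b] at that same time [n], so
    the bound for [(a, b)] in the product is a bound for [a] in [A]: hence [A] is
    completely separable. The other factor is handled by symmetry. *)

Definition separable_point (A : monounary) (a : A) : Prop :=
  exists (F : finType) (g : F -> F) (phi : A -> Monounary g),
    is_hom phi /\ ~ (phi @` ([set: A] `\` [set a])) (phi a).

Definition hit_bounded (A : monounary) (a : A) : Prop :=
  exists N, forall (x : A) n, iter n op x = a ->
    exists2 m, m <= N & iter m op x = a.

Lemma isolatedP (A : monounary) (T : Type) (phi : A -> T) (a : A) :
  ~ (phi @` ([set: A] `\` [set a])) (phi a) <->
  (forall x, phi x = phi a -> x = a).
Proof.
split=> [iso x eq_x | iso [x [_ neq_x] /iso//]].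
by apply: contrapT => neq_x; apply: iso; exists x.
Qed.

Lemma hom_iter (A B : monounary) (phi : A -> B) n (x : A) :
  is_hom phi -> phi (iter n op x) = iter n op (phi x).
Proof. by move=> hom; elim: n => //= n <-; rewrite hom. Qed.

Lemma prod_iter (A B : monounary) n (p : prod_alg A B) :
  iter n op p = (iter n op p.1, iter n op p.2).
Proof. by elim: n => [|n /= ->]; case: p. Qed.

Lemma iter_lt_card (F : finType) (g : F -> F) n (x : F) :
  exists2 m, m < #|F| & iter m g x = iter n g x.
Proof.
have conn := fconnect_iter g n x.
exists (findex g x (iter n g x)); last exact: iter_findex.
exact: leq_trans (findex_max conn) (max_card _).
Qed.

(** A map with finite range whose kernel is compatible with the operation is a
    homomorphism for a suitable operation on its codomain; outside the range that
    operation is arbitrary. *)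
Lemma kernel_hom (A : monounary) (F : finType) (phi : A -> F) :
  (forall x y, phi x = phi y -> phi (op x) = phi (op y)) ->
  exists g : F -> F, forall x, phi (op x) = g (phi x).
Proof.
move=> cong.
have /choice[g gP] : forall s, exists t, forall x, phi x = s -> phi (op x) = t.
  move=> s; have [[x <-]|no] := pselect (exists x, phi x = s).
    by exists (phi (op x)) => y /cong.
  by exists s => x eq_x; case: no; exists x.
by exists g => x; exact: gP.
Qed.

Section HittingProfile.
Variables (A : monounary) (a : A) (N : nat).
Hypothesis boundN : forall (x : A) n, iter n op x = a ->
  exists2 m, m <= N & iter m op x = a.

(** The coarsest congruence having the singleton of [a] as a class relates [x]
    and [y] when their orbits hit [a] at the same times; this records those times
    up to [N], which is enough by [profile_hit]. *)
Definition profile (x : A) : {ffun 'I_N.+1 -> bool} :=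
  [ffun i : 'I_N.+1 => `[< iter i op x = a >]].

Lemma profile_eq (x y : A) : profile x = profile y ->
  forall m, m <= N -> iter m op x = a <-> iter m op y = a.
Proof.
move=> /ffunP eq_xy m le_mN; have := eq_xy (Ordinal (le_mN : m < N.+1)).
by rewrite !ffunE => eq_hit; exact: asbool_eq_equiv eq_hit.
Qed.

(** From a common hit on, the two orbits coincide; so equal profiles force equal
    hitting times once the first hit, which occurs by time [N], is shared. *)
Lemma profile_hit (x y : A) n : profile x = profile y ->
  iter n op x = a -> iter n op y = a.
Proof.
move=> eq_xy hit; have [le_nN|lt_Nn] := leqP n N.
  exact: (profile_eq eq_xy le_nN).1 hit.
have [m le_mN hit_m] := boundN hit.
have hit_y : iter m op y = a := (profile_eq eq_xy le_mN).1 hit_m.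
have le_mn : m <= n by apply: leq_trans le_mN (ltnW lt_Nn).
by move: hit; rewrite -(subnK le_mn) !iterD hit_m hit_y.
Qed.

Lemma profile_cong (x y : A) :
  profile x = profile y -> profile (op x) = profile (op y).
Proof.
move=> eq_xy; apply/ffunP => i; rewrite !ffunE -!iterSr.
by apply: asbool_equiv_eq; split; apply: profile_hit.
Qed.

Lemma hit_bounded_separable : separable_point a.
Proof.
have [g hom_g] := kernel_hom profile_cong.
exists {ffun 'I_N.+1 -> bool}, g, profile; split=> //.
by apply/isolatedP => x /profile_eq/(_ 0 (leq0n N)) [_]; apply.
Qed.

End HittingProfile.

(** A homomorphism isolating [a] preserves and reflects hitting [a], and in a
    finite algebra every reachable point is reached in fewer steps than there are
    points. The converse is the profile construction. *)
Lemma separable_pointP (A : monounary) (a : A) :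
  separable_point a <-> hit_bounded a.
Proof.
split=> [[F [g [phi [hom /isolatedP iso]]]] | [N]]; last exact: hit_bounded_separable.
exists #|F| => x n hit; have [m lt_m eq_m] := iter_lt_card g n (phi x).
exists m; first exact: ltnW.
by apply: iso; rewrite -hit !hom_iter.
Qed.

Lemma completely_separableP (A : monounary) :
  completely_separable A <-> forall a : A, hit_bounded a.
Proof. by split=> sep a; apply/separable_pointP/sep. Qed.

Lemma completely_separable_prod (A B : monounary) :
  completely_separable A -> completely_separable B ->
  completely_separable (prod_alg A B).
Proof.
move=> sepA sepB [a b].
have [F [g [phi [homA /isolatedP isoA]]]] := sepA a.
have [G [h [psi [homB /isolatedP isoB]]]] := sepB b.
exists (F * G)%type, (fun p => (g p.1, h p.2)), (fun p => (phi p.1, psi p.2)).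
split=> [[x y]|]; first by rewrite /= homA homB.
by apply/isolatedP => -[x y] /= [/isoA-> /isoB->].
Qed.

Lemma completely_separable_swap (A B : monounary) :
  completely_separable (prod_alg A B) -> completely_separable (prod_alg B A).
Proof.
move=> sep [b a]; have [F [g [phi [hom /isolatedP iso]]]] := sep (a, b).
exists F, g, (fun p => phi (p.2, p.1)); split=> [p|].
  exact: (hom (p.2, p.1)).
by apply/isolatedP => -[y x] /iso [-> ->].
Qed.

Lemma backwards_bounded_prod (A B : monounary) :
  backwards_bounded A -> completely_separable (prod_alg A B).
Proof.
move=> bbA; apply/completely_separableP => -[a b].
have [N preN0] := bbA a; exists N => -[x y] n hit.
exists n => //; rewrite leqNgt; apply/negP => /ltnW le_Nn.
(* A hit at a time beyond N would exhibit a point of the N-th preimage of a. *)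
suff : preimage_iter N a (iter (n - N) op x) by rewrite preN0.
by move: hit; rewrite prod_iter /preimage_iter /= -iterD subnKC// => -[].
Qed.

Lemma completely_separable_factor (A B : monounary) :
  completely_separable (prod_alg A B) -> ~ backwards_bounded B ->
  completely_separable A.
Proof.
move=> /completely_separableP sep /existsNP[b /forallNP preb].
apply/completely_separableP => a; have [N boundN] := sep (a, b).
exists N => x n hit_x.
have /eqP/set0P[y hit_y] := preb n.
have [|m le_mN] := boundN (x, y) n; first by rewrite prod_iter /= hit_x hit_y.
by rewrite prod_iter => -[hit_m _]; exists m.
Qed.

Theorem theorem6p17 (A B : monounary) :
  completely_separable (prod_alg A B) <->
  (completely_separable A /\ completely_separable B) \/
  backwards_bounded A \/ backwards_bounded B.
Proof.
split=> [sep | [[sepA sepB]|[bbA|bbB]]].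
- have [bbA|nbbA] := pselect (backwards_bounded A); first by right; left.
  have [bbB|nbbB] := pselect (backwards_bounded B); first by right; right.
  left; split; first exact: completely_separable_factor sep nbbB.
  exact: completely_separable_factor (completely_separable_swap sep) nbbA.
- exact: completely_separable_prod.
- exact: backwards_bounded_prod.
- exact/completely_separable_swap/backwards_bounded_prod.
Qed.
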